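(* Let $1<\beta\le2$. For Lebesgue-almost every $x\in[0,1]$, the function $G_\beta$ is not pointwise Lipschitz continuous at $x$; that is, there is no constant $K>0$ such that $|G_\beta(y)-G_\beta(x)|\le K|y-x|$ for all $y\in[0,1]$.
   Context: Fix $1<\beta\le 2$. The beta-map is $\tau_\beta:[0,1]\to[0,1]$, $\tau_\beta(x)=\beta x-[\beta x]$, where $[y]$ is the integer part of $y$. Let $m_\beta$ be the unique $\tau_\beta$-invariant Borel probability measure absolutely continuous with respect to Lebesgue measure. For $x\in[0,1]$ and $n\ge1$ the digits are $g_n(x)=[\beta\,\tau_\beta^{n-1}(x)]$, so that $x=\sum_{n\ge1}g_n(x)\beta^{-n}$ (greedy $\beta$-expansion). Put $M_\beta=m_\beta([1/\beta,1])=\int_0^1 g_1\,dm_\beta$. The generalized Takagi function is \[ G_\beta(x)=\frac{g_1(x)}{\beta}+\sum_{n=2}^\infty\frac{g_n(x)}{\beta^n}\Bigl(n-\frac{1}{M_\beta}\sum_{i=1}^{n-1}g_i(x)\Bigr),\qquad x\in[0,1]. \] *)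

(* Defs.v *)
From HB Require Import structures.
From mathcomp Require Import all_boot all_order all_algebra.
From mathcomp Require Import all_classical all_reals all_analysis.
Set Implicit Arguments. Unset Strict Implicit. Unset Printing Implicit Defensive.
Import Order.TTheory GRing.Theory Num.Theory.
Local Open Scope classical_set_scope.
Local Open Scope ring_scope.

Definition tau {R : realType} (beta x : R) : R :=
  beta * x - (Num.floor (beta * x))%:~R.

Definition digit {R : realType} (beta : R) (n : nat) (x : R) : R :=
  (Num.floor (beta * iter n.-1 (tau beta) x))%:~R.

Definition is_acim {R : realType} (beta : R)
    (m : {measure set R -> \bar R}) : Prop :=
  [/\ m setT = 1%E,
      m (~` `[0, 1]%classic) = 0%E,
      (forall A : set R, measurable A ->
         m (tau beta @^-1` A `&` `[0, 1]%classic) = m A)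
    & m `<< (@lebesgue_measure R)].

Definition Mbeta {R : realType} (beta : R) (m : {measure set R -> \bar R}) : R :=
  fine (m `[beta^-1, 1]%classic).

(* generalized Takagi function G_beta, with M = M_beta; the series is the
   limit of its partial sums (it converges absolutely). *)
Definition Gbeta {R : realType} (beta M : R) (x : R) : R :=
  digit beta 1 x / beta +
  limn (fun N : nat => \sum_(2 <= n < N)
     (digit beta n x / beta ^+ n *
      (n%:R - M^-1 * \sum_(1 <= i < n) digit beta i x))).

(* Main.v *)
(* Write T for the beta-map, D_n(x) = sum_(i <= n) (1 - g_i(x) / M), and let y be
   the left endpoint of the n-cylinder of x, so that T^n y = 0. The functional
   equation of G gives, with z = T^n x,
     x - y = beta^-n z,   G(x) - G(y) = beta^-n (D_n(x) z + G(z)).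
   If G is Lipschitz at x, then, G being bounded, D_n(x) is bounded along the n
   with z >= 1/beta, that is, with g_(n+1)(x) = 1. A block of L zeros among the
   digits raises D by L, so the blocks of zeros of x are bounded: unless it hits
   0, the orbit of x stays away from 0. Almost no orbit does so, because T^n
   maps every n-cylinder affinely onto an interval [0, a[, of which [0, e[
   occupies at least the proportion e. The value of M plays no role. *)
Require Import Defs.
From HB Require Import structures.
From mathcomp Require Import all_boot all_order all_algebra.
From mathcomp Require Import all_classical all_reals all_analysis.
From mathcomp Require Import ring lra.
Import Order.TTheory GRing.Theory Num.Theory.
Import numFieldNormedType.Exports.
Local Open Scope classical_set_scope.
Local Open Scope ring_scope.
Set Implicit Arguments. Unset Strict Implicit. Unset Printing Implicit Defensive.

(** * Interval covers and null sets *)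

(* Finite covers by intervals of total length at most [s]: they are transported
   by affine maps by a direct induction, without measurability conditions. *)
Inductive coverable {R : realType} : set R -> R -> Prop :=
| coverable_itv (A : set R) (a b s : R) :
    A `<=` `[a, b[ -> a <= b -> b - a <= s -> coverable A s
| coverable_setU (A B C : set R) (s t u : R) :
    coverable A s -> coverable B t -> C `<=` A `|` B -> s + t <= u ->
    coverable C u.

Lemma sub_coverable {R : realType} (A B : set R) (s t : R) :
  coverable A s -> B `<=` A -> s <= t -> coverable B t.
Proof.
case=> {A s} [A a b s Aab ab bas BA st | A A' C s s' u cA cA' CAA' ssu BC ut].
  by apply: (@coverable_itv _ _ a b) => //; [exact: subset_trans BA Aab|lra].
by apply: (coverable_setU cA cA'); [exact: subset_trans BC CAA'|lra].
Qed.

Lemma coverable_set0 {R : realType} (A : set R) (s : R) :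
  A `<=` set0 -> 0 <= s -> coverable A s.
Proof.
move=> A0 s0; apply: (@coverable_itv _ _ 0 0) => //; last by rewrite subr0.
exact: subset_trans A0 (@sub0set _ _).
Qed.

Lemma coverable_affine {R : realType} (beta d : R) (A : set R) (s : R) :
  0 < beta -> coverable A s ->
  coverable [set x | A (beta * x - d)] (s / beta).
Proof.
move=> b0; elim=> {A s} [A a b s Aab ab bas | A B C s t u _ cA _ cB CAB stu].
  apply: (@coverable_itv _ _ ((a + d) / beta) ((b + d) / beta)).
  - move=> x /= /Aab /=; rewrite !in_itv/= ler_pdivrMr// ltr_pdivlMr//.
    by move=> /andP[? ?]; apply/andP; split; lra.
  - by rewrite ler_pM2r ?invr_gt0//; lra.
  - by rewrite -mulrBl ler_pM2r ?invr_gt0//; lra.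
apply: (coverable_setU cA cB); first by move=> x /= /CAB.
by rewrite -mulrDl ler_pM2r ?invr_gt0.
Qed.

Lemma coverable_measurable {R : realType} (A : set R) (s : R) :
  coverable A s ->
  exists B : set R, [/\ measurable B, A `<=` B &
    (@lebesgue_measure R B <= s%:E)%E].
Proof.
elim=> {A s} [A a b s Aab ab bas|
  A B C s t u _ [A' [mA AA lA]] _ [B' [mB BB lB]] CAB stu].
  exists `[a, b[%classic; split => //.
  rewrite (lebesgue_measure_itv `[a, b[)/= lte_fin.
  by case: ifPn => _; rewrite -?EFinB lee_fin; lra.
exists (A' `|` B'); split; first exact: measurableU.
  by move=> x /CAB[/AA|/BB]; [left|right].
rewrite (le_trans (measureU2 (@lebesgue_measure R) mA mB))//.
by rewrite (le_trans (leeD lA lB))// -EFinD lee_fin.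
Qed.

Lemma negligible_coverable {R : realType} (A : set R) :
  (forall e : R, 0 < e -> coverable A e) ->
  (@lebesgue_measure R).-negligible A.
Proof.
move=> cA.
have /choice[B BP] : forall n : nat, exists B : set R,
    [/\ measurable B, A `<=` B &
    (@lebesgue_measure R B <= n.+1%:R^-1%:E)%E].
  by move=> n; apply/coverable_measurable/cA; rewrite invr_gt0.
have mB : measurable (\bigcap_n B n).
  by apply: bigcapT_measurable => n; have [] := BP n.
exists (\bigcap_n B n); split => //; last first.
  by move=> x Ax n _; have [_ + _] := BP n; apply.
apply/eqP; rewrite eq_le measure_ge0 andbT.
apply/lee_addgt0Pr => e e0; rewrite add0e.
have [n ne] : exists n : nat, n.+1%:R^-1 <= e.
  exists (Num.trunc e^-1); rewrite -[leRHS]invrK lef_pV2 ?posrE ?invr_gt0//.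
  by rewrite ltW// truncnS_gt.
have [mBn _ lB] := BP n.
apply: (le_trans (y := lebesgue_measure (B n))).
  by rewrite le_measure ?inE//; exact: bigcap_inf.
by rewrite (le_trans lB)// lee_fin.
Qed.

(** Only the intervals $[0,a[$ are tested: cut at $1/\beta$, such an interval is mapped by each
    branch onto an interval of the same form. *)
Definition cover_density {R : realType} (E : set R) (d : R) : Prop :=
  forall a : R, 0 <= a <= 1 -> coverable (E `&` `[0, a[) (d * a).

(** * The two branches of the beta-map *)

Section expanding_map.
Context {R : realType} (beta : R).
Hypotheses (beta1 : 1 < beta) (beta2 : beta <= 2).


Let beta0 : 0 < beta. Proof. exact: lt_trans ltr01 beta1. Qed.

Lemma floor_branch0 (x : R) : 0 <= x -> x < beta^-1 ->
  Num.floor (beta * x) = 0.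
Proof.
move=> x0; rewrite -(ltr_pM2l beta0) mulfV ?gt_eqF// => xb.
by apply: floor_def; rewrite /= add0r mulr_ge0// ltW.
Qed.

(** Excluding $x = 1$ matters when $\beta = 2$, where the floor at 1 is 2; hence the work on
    $[0,1[$. *)
Lemma floor_branch1 (x : R) : beta^-1 <= x -> x < 1 ->
  Num.floor (beta * x) = 1.
Proof.
rewrite -(ler_pM2l beta0) mulfV ?gt_eqF// => x0 x1.
apply: floor_def; rewrite x0 /=.
by rewrite (_ : (1 + 1)%:~R = 2 :> R)// (lt_le_trans _ beta2)// gtr_pMr.
Qed.

Lemma tau_branch0 (x : R) : 0 <= x -> x < beta^-1 -> tau beta x = beta * x.
Proof. by move=> x0 x1; rewrite /tau floor_branch0// subr0. Qed.

Lemma tau_branch1 (x : R) : beta^-1 <= x -> x < 1 -> tau beta x = beta * x - 1.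
Proof. by move=> x0 x1; rewrite /tau floor_branch1. Qed.

Lemma tau_itv (x : R) : 0 <= tau beta x < 1.
Proof.
rewrite /tau; have /andP[] := floor_itv (beta * x).
by rewrite intrD => ? ?; apply/andP; split; lra.
Qed.

Lemma iter_tau_itv (n : nat) (x : R) : 0 <= x < 1 -> 0 <= iter n (tau beta) x < 1.
Proof. by case: n => [//|n] _; rewrite iterS; exact: tau_itv. Qed.

Lemma branch1_itv (a : R) : beta^-1 <= a -> a <= 1 -> 0 <= beta * a - 1 <= 1.
Proof.
have b2 := beta2; rewrite -(ler_pM2l beta0) mulfV ?gt_eqF// => ba a1.
have : beta * a <= beta by rewrite ger_pMr.
by move=> ab; apply/andP; split; lra.
Qed.

(** * Orbits that stay away from 0 or hit 0 *)

(** Both branches stretch lengths by $\beta$. For $a > 1/\beta$ the images $[0,1[$ and $[0,\beta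
    a-1[$ have total length $\beta a$, so the density is kept. *)
Lemma cover_density_tau (E : set R) (d : R) : 0 <= d ->
  cover_density E d -> cover_density (tau beta @^-1` E) d.
Proof.
move=> d0 Ed a /andP[a0 a1].
have [ab|ba] := leP a beta^-1.
  have ba1 : 0 <= beta * a <= 1.
    by rewrite mulr_ge0 ?(ltW beta0)//= -ler_pdivlMl// mulr1.
  apply: (sub_coverable (coverable_affine 0 beta0 (Ed _ ba1))).
    move=> x [] /= Ex; rewrite !in_itv/= subr0 => /andP[x0 xa].
    have xb : x < beta^-1 by exact: lt_le_trans xa ab.
    move: Ex; rewrite tau_branch0// => Ex; split => //.
    by rewrite /= ?in_itv/= mulr_ge0 ?(ltW beta0)//= ltr_pM2l.
  by rewrite (mulrCA d) mulrC mulKf// gt_eqF.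
have bV : beta * beta^-1 = 1 by rewrite mulfV// gt_eqF.
have aI := branch1_itv (ltW ba) a1.
have oneI : 0 <= (1:R) <= 1 by lra.
apply: (coverable_setU (coverable_affine 0 beta0 (Ed _ oneI))
   (coverable_affine 1 beta0 (Ed _ aI))).
  move=> x [] /= Ex; rewrite !in_itv/= => /andP[x0 xa].
  have xba : beta * x < beta * a by rewrite ltr_pM2l.
  have [xb|bx] := ltP x beta^-1.
    have bx1 : beta * x < 1 by rewrite -bV ltr_pM2l.
    left => /=; move: Ex; rewrite subr0 tau_branch0// => Ex; split => //.
    by rewrite /= ?in_itv/= mulr_ge0 ?(ltW beta0)//=; nra.
  have bx1 : 1 <= beta * x by rewrite -bV ler_pM2l.
  right => /=; move: Ex; rewrite tau_branch1//; last lra.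
  by move=> Ex; split => //; rewrite /= ?in_itv/=; nra.
rewrite -mulrDl -mulrDr ler_pdivrMr//; nra.
Qed.

Lemma cover_density_iter (L : nat) (E : set R) (d : R) : 0 <= d ->
  cover_density E d -> cover_density (iter L (tau beta) @^-1` E) d.
Proof.
move=> d0 Ed; elim: L => [//|L /(cover_density_tau d0)].
rewrite (_ : _ @^-1` _ = iter L.+1 (tau beta) @^-1` E)//.
by apply/seteqP; split => x; rewrite /preimage /= -iterSr.
Qed.

(* [0, beta ^- L[ is a union of [L]-cylinders, so removing it from [0, a[ removes
   its full share [d * beta ^- L] of the length. *)
Lemma coverable_iter_away (L : nat) (E : set R) (d a : R) : 0 <= d ->
  cover_density E d -> beta ^- L <= a -> a <= 1 ->
  coverable (iter L (tau beta) @^-1` E `&` `[beta ^- L, a[) (d * (a - beta ^- L)).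
Proof.
move=> d0 Ed; elim: L a => [a a1 a1'|L IH a La a1].
  apply: coverable_set0; last by rewrite expr0 invr1 in a1 *; nra.
  by move=> x [] _ /=; rewrite expr0 invr1 in a1 *; rewrite in_itv/=; lra.
have L0 : 0 < beta ^- L by rewrite invr_gt0 exprn_gt0.
have L1 : beta ^- L <= 1 by rewrite invf_le1 ?exprn_gt0// exprn_ege1// ltW.
have LS : beta * beta ^- L.+1 = beta ^- L.
  by rewrite exprS invfM mulrA mulfV ?mul1r// gt_eqF.
have bV : beta * beta^-1 = 1 by rewrite mulfV// gt_eqF.
move: LS La; move: (beta ^- L.+1) => e LS ea.
have [ab|ba] := leP a beta^-1.
  have L1a : beta ^- L <= beta * a by rewrite -LS ler_pM2l.
  have ba1 : beta * a <= 1 by rewrite -bV ler_pM2l.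
  apply: (sub_coverable (coverable_affine 0 beta0 (IH _ L1a ba1))).
    move=> x [] /= Ex; rewrite !in_itv/= subr0 => /andP[x0 xa].
    have xb : x < beta^-1 by exact: lt_le_trans xa ab.
    move: Ex; rewrite -iterS iterSr tau_branch0//; last nra.
    by move=> Ex; split => //; rewrite /= ?in_itv/= -LS ler_pM2l// ltr_pM2l ?x0.
  by rewrite -LS ler_pdivrMr//; nra.
(* The first branch is handled by induction on the whole of $[0,1[$, the second by the unreduced
   density: $d(1-\beta^{-L}) + d(\beta a-1) = d\beta(a-\beta^{-(L+1)})$. *)
have aI := branch1_itv (ltW ba) a1.
apply: (coverable_setU (coverable_affine 0 beta0 (IH _ L1 (lexx _)))
   (coverable_affine 1 beta0 (cover_density_iter L d0 Ed aI))).
  move=> x [] /=; rewrite -iterS iterSr !in_itv/= => Ex /andP[x0 xa].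
  have xba : beta * x < beta * a by rewrite ltr_pM2l.
  have [xb|bx] := ltP x beta^-1.
    have bx1 : beta * x < 1 by rewrite -bV ltr_pM2l.
    left => /=; move: Ex; rewrite subr0 tau_branch0//; last nra.
    by move=> Ex; split => //; rewrite /= ?in_itv/=; nra.
  have bx1 : 1 <= beta * x by rewrite -bV ler_pM2l.
  right => /=; move: Ex; rewrite tau_branch1//; last lra.
  by move=> Ex; split => //; rewrite /= ?in_itv/=; nra.
rewrite -mulrDl -mulrDr ler_pdivrMr//; nra.
Qed.

(** Since $a \le 1$, removing $[0,\beta^{-L}[$ takes at least the proportion $\beta^{-L}$ of
    $[0,a[$. *)
Lemma cover_density_away (L : nat) (E : set R) (d : R) : 0 <= d ->
  cover_density E d ->
  cover_density (iter L (tau beta) @^-1` E `&` `[beta ^- L, 1[)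
    ((1 - beta ^- L) * d).
Proof.
move=> d0 Ed a /andP[a0 a1].
have L0 : 0 < beta ^- L by rewrite invr_gt0 exprn_gt0.
have L1 : beta ^- L <= 1 by rewrite invf_le1 ?exprn_gt0// exprn_ege1// ltW.
have [aL|La] := ltP a (beta ^- L).
  apply: coverable_set0; last by rewrite !mulr_ge0// subr_ge0.
  by move=> x [[_]] /=; rewrite !in_itv/=; lra.
apply: (sub_coverable (coverable_iter_away d0 Ed La a1)).
  by move=> x [[Ex]] /=; rewrite !in_itv/= => /andP[? ?] /andP[? ?]; split => //;
    rewrite /= ?in_itv/=; apply/andP.
by rewrite mulrAC mulrC ler_wpM2r//; nra.
Qed.

(** The set lies in its own preimage under $T^L$ and outside $[0,\beta^{-L}[$, so
    [cover_density_away] can be applied to it repeatedly: its density is at most $(1-\beta^{-L})^k$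
    for every $k$. *)
Lemma negligible_orbit_away (L : nat) :
  (@lebesgue_measure R).-negligible
    [set x | 0 <= x < 1 /\ forall n, beta ^- L <= iter n (tau beta) x].
Proof.
set N := [set x | _].
have L0 : 0 < beta ^- L by rewrite invr_gt0 exprn_gt0.
have L1 : beta ^- L <= 1 by rewrite invf_le1 ?exprn_gt0// exprn_ege1// ltW.
have Nd k : cover_density N ((1 - beta ^- L) ^+ k).
  elim: k => [a /andP[a0 a1]|k IH].
    by rewrite expr0 mul1r; apply: (@coverable_itv _ _ 0 a) => //; rewrite subr0.
  have d0 : 0 <= (1 - beta ^- L) ^+ k by rewrite exprn_ge0// subr_ge0.
  rewrite exprS.
  move=> a aI; apply: (sub_coverable (cover_density_away L d0 IH aI)) => //.
  move=> x [[xI xN] xa]; split => //; split; last first.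
    by rewrite /= ?in_itv/=; move: (xN 0%N) => /= ->; case/andP: xI.
  split => [|n]; first exact: iter_tau_itv.
  by rewrite -iterD.
apply: negligible_coverable => e e0.
have /cvgrPdist_lt/(_ _ e0)[k _ /(_ k (leqnn k))] :
    (1 - beta ^- L) ^+ k @[k --> \oo] --> 0.
  by apply: cvg_expr; rewrite ger0_norm; lra.
rewrite /= sub0r normrN ger0_norm ?exprn_ge0 ?subr_ge0// => ke.
apply: (sub_coverable (Nd k 1 _)); first by rewrite ler01 lexx.
  by move=> x Nx; split => //; rewrite /= ?in_itv/=; case: Nx.
by rewrite mulr1 ltW.
Qed.

(** A point is determined by its image under [tau] and the integer part of $\beta x$, so each
    further preimage is a countable union of countable sets. *)
Lemma countable_iter_tau0 (n : nat) :
  countable [set x | 0 <= x < 1 /\ iter n (tau beta) x = 0].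
Proof.
elim: n => [|n IH].
  by apply: (sub_countable _ (countable1 0)); apply: subset_card_le => x [] _.
pose preim (d : int) (z : R) := (z + d%:~R) / beta.
apply: (@sub_countable _ _ _ (\bigcup_d (preim d @`
    [set x | 0 <= x < 1 /\ iter n (tau beta) x = 0]))); last first.
  apply: bigcup_countable => // d _.
  exact: card_le_trans (card_image_le _ _) IH.
apply: subset_card_le => x [_]; rewrite iterSr => Tx0.
exists (Num.floor (beta * x)) => //; exists (tau beta x).
  by split => //; exact: tau_itv.
by rewrite /preim /tau subrK mulrC mulKf// gt_eqF.
Qed.

(** * Digits and the greedy expansion *)

Lemma digit_succ (n : nat) (x : R) :
  digit beta n.+2 x = digit beta n.+1 (tau beta x).
Proof. by rewrite /digit /= -iterS iterSr. Qed.

Lemma digit_tau (n : nat) (x : R) :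
  digit beta n.+1 x = beta * iter n (tau beta) x - iter n.+1 (tau beta) x.
Proof. by rewrite /digit iterS {3}/tau opprB addrC subrK. Qed.

Lemma digit_cases (n : nat) (x : R) : 0 <= x < 1 ->
  (iter n (tau beta) x < beta^-1 /\ digit beta n.+1 x = 0) \/
  (beta^-1 <= iter n (tau beta) x /\ digit beta n.+1 x = 1).
Proof.
move=> /(iter_tau_itv n)/andP[x0 x1]; rewrite /digit /=.
have [xb|bx] := ltP (iter n (tau beta) x) beta^-1; [left|right]; split => //.
  by rewrite floor_branch0.
by rewrite floor_branch1.
Qed.

Lemma digit_itv (n : nat) (x : R) : 0 <= x < 1 -> 0 <= digit beta n.+1 x <= 1.
Proof. by move=> /(digit_cases n)[] [_ ->]; rewrite ?lexx ler01. Qed.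

(** By [digit_tau] the sum telescopes: its terms are $T^kx/\beta^k - T^{k+1}x/\beta^{k+1}$. *)
Lemma greedy_expansion (n : nat) (x : R) :
  \sum_(0 <= k < n) digit beta k.+1 x / beta ^+ k.+1 =
  x - iter n (tau beta) x / beta ^+ n.
Proof.
elim: n => [|n IH]; first by rewrite big_geq// expr0 divr1 subrr.
rewrite big_nat_recr//= IH digit_tau iterS exprS.
have bn : beta ^+ n != 0 by rewrite expf_neq0// gt_eqF.
by field; rewrite bn gt_eqF.
Qed.

Lemma cvg_greedy_expansion (x : R) : 0 <= x < 1 ->
  \sum_(0 <= k < n) digit beta k.+1 x / beta ^+ k.+1 @[n --> \oo] --> x.
Proof.
move=> x01; under eq_fun do rewrite greedy_expansion.
suff rem0 : iter n (tau beta) x / beta ^+ n @[n --> \oo] --> 0.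
  have : x - iter n (tau beta) x / beta ^+ n @[n --> \oo] --> x - 0.
    by apply: cvgB rem0; exact: cvg_cst.
  by rewrite subr0.
have r0 : `|beta^-1| < 1 by rewrite ger0_norm ?invr_ge0 ?ltW// invf_lt1.
apply: squeeze_cvgr (cvg_cst 0) (cvg_expr r0).
apply: nearW => n; have /andP[y0 y1] := iter_tau_itv n x01.
have bn : 0 < beta ^+ n by rewrite exprn_gt0.
by rewrite exprVn divr_ge0 ?(ltW bn)//= ler_pdivrMr// mulVf ?gt_eqF// ltW.
Qed.

(** The bound is the full sum of $\sum k r^k$; the missing tail is computed exactly and is
    nonnegative. *)
Lemma sum_natmul_expr_le (r : R) (n : nat) : 0 <= r < 1 ->
  \sum_(0 <= k < n) k.+1%:R * r ^+ k.+1 <= r / (1 - r) ^+ 2.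
Proof.
move=> /andP[r0 r1]; rewrite ler_pdivlMr; last by rewrite exprn_gt0// subr_gt0.
have -> : (\sum_(0 <= k < n) k.+1%:R * r ^+ k.+1) * (1 - r) ^+ 2 =
    r - r ^+ n.+1 * (1 + n%:R * (1 - r)).
  elim: n => [|n IH]; first by rewrite big_geq//; ring.
  by rewrite big_nat_recr//= mulrDl IH !exprS -!natr1; ring.
rewrite gerBl mulr_ge0 ?exprn_ge0// addr_ge0// mulr_ge0// subr_ge0; exact: ltW.
Qed.

(** * Convergence and boundedness of the Takagi series *)

Variable M : R.

(** Index $k$ stands for $n = k+1$. The inner sum is empty at $k = 0$, so the separate first term of
    [Gbeta] fits the same formula. *)
Definition takagi_term (x : R) (k : nat) : R :=
  digit beta k.+1 x / beta ^+ k.+1 *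
  (k.+1%:R - M^-1 * \sum_(0 <= i < k) digit beta i.+1 x).

Lemma takagi_term0 (x : R) : takagi_term x 0 = digit beta 1 x / beta.
Proof. by rewrite /takagi_term expr1 big_geq// mulr0 subr0 mulr1. Qed.

(** This is $(1+|1/M|)\sum_{n\ge1} n\beta^{-n}$, which will bound $|G|$ on $[0,1[$. *)
Let bound := (1 + `|M^-1|) * (beta^-1 / (1 - beta^-1) ^+ 2).

Lemma norm_takagi_term (x : R) (k : nat) : 0 <= x < 1 ->
  `|takagi_term x k| <= (1 + `|M^-1|) * (k.+1%:R * beta^-1 ^+ k.+1).
Proof.
move=> x01; rewrite /takagi_term normrM normf_div.
have bk : 0 < beta ^+ k.+1 by rewrite exprn_gt0.
rewrite (gtr0_norm bk) exprVn.
have /andP[d0 d1] := digit_itv k x01; rewrite (ger0_norm d0).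
have S0 : 0 <= \sum_(0 <= i < k) digit beta i.+1 x.
  by apply: sumr_ge0 => i _; case/andP: (digit_itv i x01).
have Sk : \sum_(0 <= i < k) digit beta i.+1 x <= k.+1%:R.
  rewrite (@le_trans _ _ (\sum_(0 <= i < k) 1))//.
    by apply: ler_sum => i _; case/andP: (digit_itv i x01).
  by rewrite sumr_const_nat subn0 ler_nat.
have Hn : `|k.+1%:R - M^-1 * \sum_(0 <= i < k) digit beta i.+1 x| <=
    (1 + `|M^-1|) * k.+1%:R.
  rewrite (le_trans (ler_normB _ _))// mulrDl mul1r normr_nat lerD2l.
  by rewrite normrM (ger0_norm S0) ler_wpM2l.
rewrite [leRHS]mulrA [leRHS]mulrC ler_pM ?divr_ge0 ?(ltW bk)//.
by rewrite ler_piMl// invr_ge0 ltW.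
Qed.

Lemma sum_norm_takagi_term (x : R) (n : nat) : 0 <= x < 1 ->
  \sum_(0 <= k < n) `|takagi_term x k| <= bound.
Proof.
move=> x01.
rewrite (@le_trans _ _
  (\sum_(0 <= k < n) (1 + `|M^-1|) * (k.+1%:R * beta^-1 ^+ k.+1)))//.
  by apply: ler_sum => k _; exact: norm_takagi_term.
rewrite -mulr_sumr ler_wpM2l ?addr_ge0//; apply: sum_natmul_expr_le.
by rewrite invr_ge0 (ltW beta0) invf_lt1.
Qed.

Lemma is_cvg_takagi (x : R) : 0 <= x < 1 -> cvgn (series (takagi_term x)).
Proof.
move=> x01; apply: normed_cvg; apply: nondecreasing_is_cvgn.
  by apply: nondecreasing_series => n _ _ /=.
by exists bound => _ [n _ <-]; exact: sum_norm_takagi_term.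
Qed.

Lemma GbetaE (x : R) : 0 <= x < 1 ->
  Gbeta beta M x = limn (series (takagi_term x)).
Proof.
move=> /is_cvg_takagi ct; rewrite /Gbeta -takagi_term0.
rewrite -[RHS](subrKC (takagi_term x 0)); congr (_ + _).
(* With $N = n+2$, the sum over $2 \le k < N$ consists of the first $n+1$ terms of the series
   without the term of index 0. *)
apply/cvg_lim => //; rewrite -(cvg_shiftn 2).
rewrite (_ : (fun n => _) =
  (fun n => series (takagi_term x) n.+1 - takagi_term x 0)).
  by apply: cvgB; [rewrite cvg_shiftS|exact: cvg_cst].
apply/funext => n /=; rewrite /series /= big_nat_recl//.
rewrite (addrC (takagi_term x 0)) addrK.
rewrite -{1}(add0n 2%N) big_addn addnK.
apply: eq_bigr => k _; rewrite /takagi_term addn2.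
by rewrite (big_add1 _ _ 0 k.+2).
Qed.

Lemma cvg_takagi (x : R) : 0 <= x < 1 ->
  series (takagi_term x) @ \oo --> Gbeta beta M x.
Proof. by move=> x01; rewrite GbetaE//; exact: is_cvg_takagi. Qed.

Lemma norm_Gbeta (x : R) : 0 <= x < 1 -> `|Gbeta beta M x| <= bound.
Proof.
move=> x01; apply: (cvgr_to_le (cvg_norm (cvg_takagi x01))).
apply: nearW => n; apply: le_trans (sum_norm_takagi_term n x01).
exact: ler_norm_sum.
Qed.

(** * The functional equation and increments along cylinders *)

(** Passing from $Tx$ to $x$ raises each index $n$ by one and adds $g_1(x)$ to each inner sum. The
    weights thus change by $1-g_1(x)/M$, which multiplies the greedy expansion of $Tx$. *)
Lemma Gbeta_tau (x : R) : 0 <= x < 1 ->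
  Gbeta beta M x = (digit beta 1 x + Gbeta beta M (tau beta x) +
    (1 - M^-1 * digit beta 1 x) * tau beta x) / beta.
Proof.
move=> x01; have Tx01 := tau_itv x.
have termS k : takagi_term x k.+1 = (takagi_term (tau beta x) k +
    (1 - M^-1 * digit beta 1 x) *
      (digit beta k.+1 (tau beta x) / beta ^+ k.+1)) / beta.
  rewrite /takagi_term digit_succ big_nat_recl//.
  under eq_bigr do rewrite digit_succ.
  rewrite [beta ^+ k.+2]exprS -!natr1 invfM.
  by ring.
have sumS n : series (takagi_term x) n.+1 = (digit beta 1 x +
    series (takagi_term (tau beta x)) n + (1 - M^-1 * digit beta 1 x) *
    \sum_(0 <= k < n) digit beta k.+1 (tau beta x) / beta ^+ k.+1) / beta.
  rewrite /series /= big_nat_recl// (eq_bigr _ (fun k _ => termS k)) -mulr_suml.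
  rewrite big_split/= -mulr_sumr takagi_term0.
  by rewrite -mulrDl addrA.
have := cvg_takagi x01; rewrite -cvg_shiftS => /cvg_lim <- //.
apply/cvg_lim => //=; under eq_fun do rewrite sumS.
apply: cvgMr_tmp; apply: cvgD; last exact: cvgMl_tmp (cvg_greedy_expansion Tx01).
by apply: cvgD; [exact: cvg_cst|exact: cvg_takagi].
Qed.

(** 0 is a fixed point with digit 0, so the functional equation reads $G(0) = G(0)/\beta$. *)
Lemma Gbeta0 : Gbeta beta M 0 = 0.
Proof.
have T0 : tau beta 0 = 0 by rewrite tau_branch0 ?mulr0 ?invr_gt0.
have := @Gbeta_tau 0; rewrite lexx ltr01 T0 => /(_ isT).
rewrite (_ : digit beta 1 0 = 0); last by rewrite digit_tau /= T0 mulr0 subrr.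
rewrite mulr0 add0r addr0 => /eqP.
rewrite eq_sym -subr_eq0 -{2}(mulr1 (Gbeta beta M 0)) -mulrBr mulf_eq0.
by rewrite subr_eq0 invr_eq1 (gt_eqF beta1) orbF => /eqP.
Qed.

(** This is $D_n$, the slope accumulated when the functional equation is used $n$ times. *)
Definition drift (n : nat) (x : R) : R :=
  \sum_(0 <= i < n) (1 - M^-1 * digit beta i.+1 x).

(* [y] is the left endpoint of the [n]-cylinder of [x]: it shares the first [n]
   digits of [x] and [T ^ n y = 0]. *)
Lemma Gbeta_cylinder (n : nat) (x : R) : 0 <= x < 1 ->
  exists y, [/\ 0 <= y < 1, x - y = iter n (tau beta) x / beta ^+ n &
    Gbeta beta M x - Gbeta beta M y =
    (drift n x * iter n (tau beta) x + Gbeta beta M (iter n (tau beta) x))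
      / beta ^+ n].
Proof.
elim: n x => [|n IH] x x01.
  exists 0; split; first by rewrite lexx ltr01.
    by rewrite /= expr0 divr1 subr0.
  by rewrite Gbeta0 /drift big_geq// mul0r add0r expr0 divr1 subr0.
have [y [/andP[y0 y1] xy Gxy]] := IH (tau beta x) (tau_itv x).
have [/andP[z0 z1] bn] := (iter_tau_itv n (tau_itv x), exprn_gt0 n beta0).
have yT : y <= tau beta x by rewrite -subr_ge0 xy divr_ge0// ltW.
have bV : beta * beta^-1 = 1 by rewrite mulfV// gt_eqF.
have /andP[d0 d1] := digit_itv 0 x01.
(* Pull $y$ back along the branch through $x$. From $y \le Tx$ comes $y' \le x < 1$, and $0 \le y <
   1$ makes the first digits of $y'$ and $x$ agree. *)
pose y' := (y + digit beta 1 x) / beta.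
have xE : x = (tau beta x + digit beta 1 x) / beta.
  by rewrite /tau /digit /= subrK mulrC mulKf// gt_eqF.
have y'x : y' <= x by rewrite [leRHS]xE ler_pM2r ?invr_gt0// lerD2r.
have y'0 : 0 <= y' by rewrite divr_ge0 ?addr_ge0// ltW.
have y'01 : 0 <= y' < 1 by rewrite y'0; case/andP: x01 => _; exact: le_lt_trans.
have by' : beta * y' = y + digit beta 1 x by rewrite /y' mulrC divfK// gt_eqF.
have dy' : digit beta 1 y' = digit beta 1 x.
  rewrite {1}/digit /= by' /digit /=; congr (_%:~R); apply: floor_def.
  by rewrite intrD; apply/andP; split; lra.
have Ty' : tau beta y' = y.
  have := digit_tau 0 y'; rewrite /= dy' by' => dE; lra.
exists y'; split => //.
  by rewrite {1}xE /y' -mulrBl opprD addrACA subrr addr0 xy iterSr exprS invfM; ring.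
rewrite Gbeta_tau// [X in _ - X]Gbeta_tau// dy' Ty' iterSr.
rewrite /drift big_nat_recl//.
under eq_bigr do rewrite digit_succ.
rewrite -/(drift n (tau beta x)) exprS invfM -mulrBl.
set c := M^-1 * _.
(* The digit terms cancel, and $1-c$ is the first summand of [drift n.+1 x]. *)
rewrite (_ : _ - _ = Gbeta beta M (tau beta x) - Gbeta beta M y +
  (1 - c) * (tau beta x - y)); last by ring.
by rewrite Gxy xy; ring.
Qed.

Lemma driftS (n : nat) (x : R) :
  drift n.+1 x = drift n x + (1 - M^-1 * digit beta n.+1 x).
Proof. by rewrite /drift big_nat_recr. Qed.

(** * Bounds forced by a Lipschitz constant at a point *)

Section pointwise_lipschitz.
Variables (x K : R).
Hypothesis x01 : 0 <= x < 1.
Hypothesis orbit_gt0 : forall n, 0 < iter n (tau beta) x.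
Hypothesis lipx : forall y, y \in `[0, 1] ->
  `|Gbeta beta M y - Gbeta beta M x| <= K * `|y - x|.

Let drift_bound := K + bound * beta.

(** The Lipschitz bound at the left endpoint $y$ gives $|D_n z + G(z)| \le Kz$ with $z = T^nx$. As
    $\beta z \ge 1$, $|G(z)|$ is at most [bound] times $\beta z$, and $z$ can be divided out. *)
Lemma norm_drift_digit1 (n : nat) :
  beta^-1 <= iter n (tau beta) x -> `|drift n x| <= drift_bound.
Proof.
move=> bz; have [y [/andP[y0 y1] xy Gxy]] := Gbeta_cylinder n x01.
have bn : 0 < beta ^+ n by rewrite exprn_gt0.
have z0 := orbit_gt0 n; have := norm_Gbeta (iter_tau_itv n x01).
have : y \in `[0, 1] by rewrite in_itv/= y0 ltW.
move=> /lipx; rewrite distrC Gxy distrC xy !normf_div.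
rewrite (gtr0_norm bn) (gtr0_norm z0).
rewrite mulrA ler_pM2r ?invr_gt0//.
move: (iter _ _ _) (Gbeta _ _ _) bz z0 => z g bz z0 Dg gb.
have bz1 : 1 <= beta * z by rewrite -(mulfV (lt0r_neq0 beta0)) ler_pM2l.
have b0 : 0 <= bound by apply: le_trans gb.
have Dz : `|drift n x| * z <= K * z + bound * (beta * z).
  rewrite -{1}(gtr0_norm z0) -normrM -[drift n x * z](addrK g).
  rewrite (le_trans (ler_normB _ _))// lerD// (le_trans gb)//.
  by rewrite ler_peMr.
by rewrite -(ler_pM2r z0) /drift_bound mulrDl -mulrA.
Qed.

(** A digit 0 increases the drift. At a digit 1 the value before the step is bounded by
    [norm_drift_digit1], and the step changes it by $1-1/M$. *)
Lemma drift_ge (n : nat) : - (`|drift_bound| + `|1 - M^-1|) <= drift n x.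
Proof.
elim: n => [|n IH]; first by rewrite /drift big_geq// oppr_le0 addr_ge0.
rewrite driftS; case: (digit_cases n x01) => -[zb ->].
  by rewrite mulr0 subr0 (le_trans IH)// lerDl.
have := le_trans (norm_drift_digit1 zb) (ler_norm _).
rewrite ler_norml mulr1 => /andP[Dn _].
by rewrite opprD lerD// lerNl (le_trans (ler_norm _))// normrN.
Qed.

(** Below $\beta^{-L}$ the next $L$ digits are 0 and each adds 1 to the drift. Further zeros only
    raise it, until a digit 1 occurs. *)
Lemma exists_digit1_drift_ge (n L : nat) : iter n (tau beta) x < beta ^- L ->
  exists2 p, beta^-1 <= iter p (tau beta) x & drift n x + L%:R <= drift p x.
Proof.
have step m : iter m (tau beta) x < beta^-1 ->
    iter m.+1 (tau beta) x = beta * iter m (tau beta) x /\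
    drift m.+1 x = drift m x + 1.
  move=> zb; have [[_ d0]|[]] := digit_cases m x01; last by rewrite leNgt zb.
  split; last by rewrite driftS d0 mulr0 subr0.
  by apply/esym/eqP; rewrite -subr_eq0 -digit_tau d0.
elim: L n => [|L IH] n.
  move=> _; rewrite addr0.
  (* Being positive, the orbit point grows by the factor $\beta$ at each digit 0; $k$ bounds the
     number of steps to the first digit 1. *)
  have [k] : exists k, beta^-1 <= beta ^+ k * iter n (tau beta) x.
    have z0 := orbit_gt0 n.
    have r1 : `|beta^-1| < 1.
      by rewrite ger0_norm ?invr_ge0 ?(ltW beta0)// invf_lt1.
    have /cvgrPdist_lt/(_ _ (mulr_gt0 beta0 z0))[k _ /(_ k (leqnn k))] :=
      cvg_expr r1.
    rewrite /= sub0r normrN exprVn ger0_norm ?invr_ge0 ?exprn_ge0 ?(ltW beta0)//.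
    move=> kz; exists k; rewrite -(ler_pM2l beta0) mulfV ?gt_eqF// mulrCA.
    by rewrite -ler_pdivrMl ?exprn_gt0// mulr1 ltW.
  elim: k n => [|k IHk] n; first by rewrite expr0 mul1r => ?; exists n.
  have [zb|?] := ltP (iter n (tau beta) x) beta^-1; last by move=> _; exists n.
  have [zS DS] := step n zb.
  rewrite exprSr -mulrA -zS => /IHk[p bp Dp]; exists p => //.
  by rewrite (le_trans _ Dp)// DS lerDl.
move=> zL; have zb : iter n (tau beta) x < beta^-1.
  rewrite (lt_le_trans zL)// exprS invfM ler_piMr ?invr_ge0 ?(ltW beta0)//.
  by rewrite invf_le1 ?exprn_gt0// exprn_ege1// ltW.
have [zS DS] := step n zb.
have /IH[p bp Dp] : iter n.+1 (tau beta) x < beta ^- L.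
  by rewrite zS -ltr_pdivlMl// -invfM -exprS.
by exists p => //; rewrite (le_trans _ Dp)// DS -natr1 addrAC addrA.
Qed.

Lemma lipschitz_orbit_away : exists L, forall n, beta ^- L <= iter n (tau beta) x.
Proof.
(* [L] exceeds the gap between the upper bound for the drift at a digit 1 and the lower bound of
   [drift_ge]. *)
pose L := (Num.trunc (2 * `|drift_bound| + `|1 - M^-1|)).+1.
exists L => n; rewrite leNgt; apply/negP => /exists_digit1_drift_ge[p bp].
have := le_trans (norm_drift_digit1 bp) (ler_norm _).
rewrite ler_norml => /andP[_ Dp]; have Dn := drift_ge n.
have : 2 * `|drift_bound| + `|1 - M^-1| < L%:R by exact: truncnS_gt.
lra.
Qed.

End pointwise_lipschitz.

End expanding_map.

(** * The almost everywhere statement *)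

Unset Implicit Arguments.

Theorem theorem4p1 (R : realType) (beta : R) (m : {measure set R -> \bar R}) :
  1 < beta -> beta <= 2 -> is_acim beta m ->
  {ae (@lebesgue_measure R), forall x : R, x \in `[0, 1] ->
     ~ (exists K : R, 0 < K /\
          forall y : R, y \in `[0, 1] ->
            `|Gbeta beta (Mbeta beta m) y - Gbeta beta (Mbeta beta m) x|
              <= K * `|y - x|)}.
Proof.
move=> b1 b2 _; set M := Mbeta beta m.
have b0 : 0 < beta by exact: lt_trans b1.
pose hit0 n := [set x | 0 <= x < 1 /\ iter n (tau beta) x = 0].
pose away L := [set x | 0 <= x < 1 /\ forall n, beta ^- L <= iter n (tau beta) x].
(* The exceptional points are 1, which lies outside the range $[0,1[$ of the lemmas, the countably
   many points whose orbit hits 0, and those whose orbit stays away from 0. *)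
apply: (@negligibleS _ _ _ (@lebesgue_measure R)
    ([set 1] `|` \bigcup_n hit0 n `|` \bigcup_L away L)).
  move=> x /= /not_implyP[]; rewrite in_itv/= => /andP[x0 x1] /contrapT[K [K0 lipx]].
  have [->|xn1] := eqVneq x 1; first by left; left.
  have x01 : 0 <= x < 1 by rewrite x0 lt_neqAle xn1.
  have [[n xn]|nhit] := pselect (exists n, iter n (tau beta) x = 0).
    by left; right; exists n.
  right; have orbit_gt0 n : 0 < iter n (tau beta) x.
    have /andP[z0 _] := iter_tau_itv beta n x01.
    by rewrite lt_neqAle z0 andbT eq_sym; apply/eqP => zn; apply: nhit; exists n.
  have [L xL] := lipschitz_orbit_away b1 b2 x01 orbit_gt0 lipx.
  by exists L.
apply: negligibleU; last first.
  by apply: negligible_bigcup => L; exact: negligible_orbit_away.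
apply: negligibleU; first exact/negligibleP/lebesgue_measure_set1.
apply: negligible_bigcup => n; apply/negligibleP.
  apply: countable_measurable; last exact: countable_iter_tau0.
  by move=> z; exact: measurable_set1.
exact/countable_lebesgue_measure0/countable_iter_tau0.
Qed.
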